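(* For any finite simple graph $G$ with $n$ vertices and $m \geq 1$ edges, with largest adjacency eigenvalue $\lambda_1$, $$s^+(G) \geq \frac{m^{4/3}}{n^{1/3}\lambda_1^{2/3}}.$$
   Context: For a finite simple graph $G$ with adjacency matrix eigenvalues $\lambda_1 \geq \cdots \geq \lambda_n$, $s^+(G) = \sum_{i:\lambda_i \geq 0} \lambda_i^2$. *)

(* Defs.v *)
From mathcomp Require Import all_boot all_order all_algebra.
From mathcomp Require Import reals exp.
From mathcomp Require Import polyrcf complex.

Set Implicit Arguments.
Unset Strict Implicit.
Unset Printing Implicit Defensive.

Import Order.TTheory GRing.Theory Num.Theory.
Local Open Scope ring_scope.

Record sgraph := SGraph {
  vertex :> finType;
  adj : rel vertex;
  adj_sym : symmetric adj;
  adj_irrefl : irreflexive adj }.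

Definition edges (G : sgraph) : {set {set G}} :=
  [set [set p.1; p.2] | p : G * G & adj p.1 p.2].

Definition adjmx (R : realType) (G : sgraph) : 'M[R]_#|G| :=
  \matrix_(i, j) (adj (enum_val i) (enum_val j))%:R.

(* The real eigenvalues of A, each repeated according to its algebraic
   multiplicity, in nonincreasing order (rootsR lists the distinct real roots
   in increasing order). *)
Definition eigenvalues (R : realType) (n : nat) (A : 'M[R]_n) : seq R :=
  flatten [seq nseq (mup x (char_poly A)) x | x <- rev (rootsR (char_poly A))].

Lemma real_sym_split (R : rcfType) n (A : 'M[R]_n) : A^T = A ->
  exists s : seq R, char_poly A = \prod_(x <- s) ('X - x%:P).
Proof.
move=> As; pose f := real_complex R; pose B := map_mx f A.
have Bh : B \is hermsymmx.
  apply/is_hermitianmxP; rewrite expr0 scale1r /B; apply/matrixP => i j.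
  by rewrite !mxE -[in LHS]As mxE; apply/esym/conjc_real.
have /orthomx_spectralP Beq := hermitian_normalmx Bh.
have /mxOverP Dr := hermitian_spectral_diag_real Bh.
set P := spectralmx B in Beq; set D := spectral_diag B in Beq Dr.
have Pu : P \in unitmx by exact: spectral_unit.
exists [seq complex.Re (D 0 i) | i <- enum 'I_n].
apply: (map_poly_inj f); rewrite map_char_poly -/B.
have -> : char_poly B = char_poly (diag_mx D).
  have similar : P *m B = diag_mx D *m P.
    by rewrite Beq !mulmxA mulmxV // mul1mx.
  rewrite /char_poly /char_poly_mx.
  set Pp := map_mx polyC P.
  have Ppu : \det Pp != 0 by rewrite det_map_mx polyC_eq0 -unitfE -unitmxE.
  apply: (mulfI Ppu); rewrite -det_mulmx [RHS]mulrC -det_mulmx.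
  rewrite mulmxBr mulmxBl -!map_mxM similar; congr (\det (_ - _)).
  by rewrite scalar_mxC.
rewrite char_poly_trig ?diag_mx_is_trig // rmorph_prod /= big_map big_enum /=.
apply: eq_bigr => i _; rewrite mxE eqxx mulr1n rmorphB /= map_polyX map_polyC /=.
by rewrite RRe_real // Dr.
Qed.

Lemma eigenvalues_split (R : realType) n (A : 'M[R]_n) : A^T = A ->
  char_poly A = \prod_(x <- eigenvalues A) ('X - x%:P).
Proof.
move=> /real_sym_split[s ps].
suff /permP E : perm_eq (eigenvalues A) s by rewrite ps; apply: perm_big; rewrite perm_sym; apply/permP.
have nz : char_poly A != 0 by rewrite monic_neq0 // char_poly_monic.
apply/allP => x _ /=; apply/eqP.
rewrite -[RHS]mu_prod_XsubC -ps count_flatten -map_comp sumnE big_map big_rev /=.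
have := roots_on_rootsR nz x; rewrite inE /= => rx.
have un : uniq (rootsR (char_poly A)).
  exact/lt_sorted_uniq/sorted_roots.
under eq_bigr do rewrite /= count_nseq /=.
case: (boolP (x \in rootsR (char_poly A))) => xr.
  rewrite (bigD1_seq x) //= eqxx mul1n big1 ?addn0 // => y /negPf ->.
  by rewrite mul0n.
rewrite big1_seq => [|y /= yr].
  by rewrite mupNroot // rx.
by case: eqP => // E; rewrite -E yr in xr.
Qed.

Lemma eigenvalues_sorted (R : realType) n (A : 'M[R]_n) :
  sorted >=%R (eigenvalues A).
Proof.
rewrite /eigenvalues.
have : sorted >%R (rev (rootsR (char_poly A))).
  by rewrite rev_sorted; exact: sorted_roots.
elim: (rev _) => //= x s IH xs.
rewrite sorted_pairwise; last by move=> a b c /[swap] /le_trans h /h.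
rewrite pairwise_cat -sorted_pairwise -?sorted_pairwise ?IH ?(path_sorted xs) //;
  try by move=> a b c /[swap] /le_trans h /h.
rewrite andbT; apply/andP; split; last first.
  by elim: (mup x (char_poly A)) => [|[|k] IHk] //=; rewrite ?lexx.
apply/allrelP => a b /nseqP[-> _] /flatten_mapP[y ys /nseqP[-> _]].
have tr : transitive (>%R : rel R) by move=> u v w /[swap] /lt_trans h /h.
exact/ltW/(allP (order_path_min tr xs) y ys).
Qed.

(* The default value 0 is only reached by the graph without vertices. *)
Definition lambda1 (R : realType) (G : sgraph) : R :=
  head 0 (eigenvalues (adjmx R G)).

Definition s_plus (R : realType) (G : sgraph) : R :=
  \sum_(x <- eigenvalues (adjmx R G) | 0 <= x) x ^+ 2.

(* Main.v *)
(** Let p and r be the sums of the squares of the nonnegative and of the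
    negative eigenvalues.  Since tr A = 0 and tr A^3 >= 0, the negative
    eigenvalues satisfy
      sum |x| = sum_(x >= 0) x <= sqrt (n p)  and
      sum |x|^3 <= sum_(x >= 0) x^3 <= lambda1 p,
    so Cauchy-Schwarz gives r^4 <= n lambda1^2 p^3.  As p + r = tr A^2 = 2 m,
    either r >= m, and m^4 <= n lambda1^2 p^3 follows, or p >= m, and it
    follows from p <= n lambda1^2. *)

Require Import Defs.
From mathcomp Require Import all_boot all_order all_algebra.
From mathcomp Require Import reals exp.
From mathcomp Require Import complex lra.

Import Order.TTheory GRing.Theory Num.Theory.

Local Open Scope ring_scope.

(** * Inequalities for finite real sequences *)

Lemma weighted_cauchy_schwarz {R : realFieldType} {I : Type} (s : seq I)
    (P : pred I) (w y : I -> R) : (forall i, P i -> 0 <= w i) ->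
  (\sum_(i <- s | P i) w i * y i) ^+ 2 <=
  (\sum_(i <- s | P i) w i) * \sum_(i <- s | P i) w i * y i ^+ 2.
Proof.
move=> w_ge0; elim: s => [|i s SWQ]; first by rewrite !big_nil expr0n mulr0.
rewrite !big_cons; case: ifP => // /w_ge0.
have : 0 <= \sum_(j <- s | P j) w j by exact: sumr_ge0.
have : 0 <= \sum_(j <- s | P j) w j * y j ^+ 2.
  by apply: sumr_ge0 => j Pj; rewrite mulr_ge0 ?sqr_ge0 ?w_ge0.
move: (w i) (y i) (\sum_(j <- s | P j) w j * y j ^+ 2)
  (\sum_(j <- s | P j) w j * y j) (\sum_(j <- s | P j) w j) SWQ
  => a b Q S W SWQ Q0 W0 a0.
(* With head weight [a], head value [b] and tail sums [W], [S], [Q], expanding and using [SWQ]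
   leaves only the cross term 2abS <= a(Q + Wb^2). *)
suff amgm : 2 * b * S <= Q + W * b ^+ 2.
  have := ler_wpM2l a0 amgm.
  by nra.
have rhs0 : 0 <= Q + W * b ^+ 2 by exact: addr_ge0 Q0 (mulr_ge0 W0 (sqr_ge0 b)).
apply: le_trans (ler_norm _) _.
(* After squaring: 4b^2S^2 <= 4b^2WQ <= (Q + Wb^2)^2, the last gap being (Q - Wb^2)^2. *)
rewrite -(@ler_pXn2r _ 2) ?nnegrE // real_normK ?num_real //.
have := ler_wpM2l (sqr_ge0 (2 * b)) SWQ.
have := sqr_ge0 (Q - W * b ^+ 2).
by nra.
Qed.

Lemma sum_cond_ge0 {R : realDomainType} (s : seq R) (F : R -> R) :
  \sum_(x <- s) F x =
  \sum_(x <- s | 0 <= x) F x + \sum_(x <- s | x < 0) F x.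
Proof.
rewrite (bigID (fun x => 0 <= x)) /=; congr (_ + _).
by apply: eq_bigl => x; rewrite ltNge.
Qed.

(** The spectrum enters only through its size, an upper bound and its first three power sums. Below,
    [T], [p], [C] are these power sums over the nonnegative entries, and [U], [r], [D] those over
    the negative ones. *)
Lemma pos_square_sum_bound {R : realFieldType} (s : seq R) (L m : R) :
  0 <= m -> {in s, forall x, x <= L} ->
  \sum_(x <- s) x = 0 -> 2 * m <= \sum_(x <- s) x ^+ 2 ->
  0 <= \sum_(x <- s) x ^+ 3 ->
  m ^+ 4 <= (size s)%:R * L ^+ 2 * (\sum_(x <- s | 0 <= x) x ^+ 2) ^+ 3.
Proof.
move=> m0 sL; rewrite !sum_cond_ge0.
set p := \sum_(x <- s | 0 <= x) x ^+ 2.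
set r := \sum_(x <- s | x < 0) x ^+ 2.
set T := \sum_(x <- s | 0 <= x) x.
set U := \sum_(x <- s | x < 0) x.
set C := \sum_(x <- s | 0 <= x) x ^+ 3.
set D := \sum_(x <- s | x < 0) x ^+ 3.
move=> TU mpr CD.
have p0 : 0 <= p by apply: sumr_ge0 => x _; exact: sqr_ge0.
have r0 : 0 <= r by apply: sumr_ge0 => x _; exact: sqr_ge0.
have count_le : \sum_(x <- s | 0 <= x) 1 <= (size s)%:R :> R.
  by rewrite -sum1_size natr_sum (sum_cond_ge0 s (fun=> 1)) lerDl sumr_ge0.
have pL : p <= (size s)%:R * L ^+ 2.
  apply: (@le_trans _ _ (\sum_(x <- s | 0 <= x) L ^+ 2)).
    rewrite /p big_seq_cond [leRHS]big_seq_cond.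
    apply: ler_sum => x /andP[xs x0].
    have xL := sL x xs.
    by apply: lerXn2r => //; rewrite nnegrE // (le_trans x0).
  under eq_bigr do rewrite -[L ^+ 2]mul1r.
  by rewrite -mulr_suml; apply: (ler_wpM2r (sqr_ge0 L)); exact: count_le.
have CL : C <= L * p.
  rewrite /C /p mulr_sumr big_seq_cond [leRHS]big_seq_cond.
  apply: ler_sum => x /andP[xs _].
  by rewrite exprS; apply: (ler_wpM2r (sqr_ge0 x)); exact: sL.
have TT : T ^+ 2 <= (size s)%:R * p.
  have /= := @weighted_cauchy_schwarz R _ s (fun x => 0 <= x) (fun=> 1) id
    (fun _ _ => ler01).
  under eq_bigr do rewrite mul1r.
  under [X in _ <= _ * X]eq_bigr do rewrite mul1r.
  by move=> /le_trans; apply; rewrite ler_wpM2r.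
(* Cauchy-Schwarz with weights and values both |x|; the total weight is -U = T. *)
have rr : r ^+ 2 <= T * - D.
  have -> : r = \sum_(x <- s | x < 0) - x * - x.
    by apply: eq_bigr => x _; rewrite mulrNN expr2.
  have -> : - D = \sum_(x <- s | x < 0) - x * (- x) ^+ 2.
    by rewrite -sumrN; apply: eq_bigr => x _; rewrite sqrrN mulNr -exprS.
  have -> : T = \sum_(x <- s | x < 0) - x by rewrite sumrN -/U; lra.
  by apply: weighted_cauchy_schwarz => x x0; rewrite oppr_ge0 ltW.
have T0 : 0 <= T by exact: sumr_ge0.
(* If r < m, then m <= p <= nL^2 with n the size of [s], so m * m^3 <= nL^2 * p^3. *)
have [mr|rm] := leP m r; last first.
  have mp : m <= p by lra.
  by rewrite exprS ler_pM ?exprn_ge0 ?(le_trans mp) // lerXn2r ?nnegrE //.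
have rTLp : r ^+ 2 <= T * (L * p).
  by apply: le_trans rr _; rewrite ler_wpM2l //; lra.
(* Squaring produces T^2, which [TT] bounds by np. *)
have : (r ^+ 2) ^+ 2 <= (T * (L * p)) ^+ 2.
  by rewrite lerXn2r ?nnegrE ?sqr_ge0 ?(le_trans (sqr_ge0 r)).
rewrite -exprM => r4; apply: (@le_trans _ _ (r ^+ 4)).
  by rewrite lerXn2r ?nnegrE.
apply: le_trans r4 _; rewrite exprMn.
apply: le_trans (ler_wpM2r (sqr_ge0 _) TT) _.
by lra.
Qed.

(** * Traces of powers of a symmetric matrix *)

(** Over the complex extension the matrix is unitarily diagonalizable, and the trace of a power is
    read off the diagonal form. *)
Lemma mxtrace_exp_sym {R : rcfType} n (A : 'M[R]_n) (s : seq R) k :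
  A^T = A -> char_poly A = \prod_(x <- s) ('X - x%:P) ->
  \tr (A ^+ k) = \sum_(x <- s) x ^+ k.
Proof.
move=> As cA; pose f := real_complex R; pose B := map_mx f A.
have Bh : B \is hermsymmx.
  apply/is_hermitianmxP; rewrite expr0 scale1r /B; apply/matrixP => i j.
  by rewrite !mxE -[in LHS]As mxE; apply/esym/conjc_real.
have /orthomx_spectralP Beq := hermitian_normalmx Bh.
set P := spectralmx B in Beq; set D := spectral_diag B in Beq.
have Pu : P \in unitmx by exact: spectral_unit.
have PB : P *m B = diag_mx D *m P by rewrite Beq !mulmxA mulmxV // mul1mx.
have PBk : P *m B ^+ k = diag_mx D ^+ k *m P.
  elim: k => [|k IH]; first by rewrite !expr0 mulmx1 mul1mx.
  by rewrite !exprS mulmxA PB -mulmxA IH mulmxA.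
have Dk : diag_mx D ^+ k = diag_mx (\row_i D 0 i ^+ k).
  elim: k {PBk} => [|k IH].
    by apply/matrixP => i j; rewrite !mxE expr0.
  rewrite exprS IH; apply/matrixP => i j.
  by rewrite -[_ * _]/(_ *m _) mul_diag_mx !mxE mulrnAr exprS.
have cB : char_poly B = \prod_i ('X - (D 0 i)%:P).
  have -> : char_poly B = char_poly (diag_mx D).
    rewrite /char_poly /char_poly_mx.
    set Pp := map_mx polyC P.
    have Ppu : \det Pp != 0 by rewrite det_map_mx polyC_eq0 -unitfE -unitmxE.
    (* Take determinants in P(X - B) = (X - diag D)P and cancel det P. *)
    apply: (mulfI Ppu); rewrite -det_mulmx [RHS]mulrC -det_mulmx.
    by rewrite mulmxBr mulmxBl -!map_mxM PB scalar_mxC.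
  rewrite char_poly_trig ?diag_mx_is_trig //.
  by apply: eq_bigr => i _; rewrite mxE eqxx mulr1n.
(* Equal products of monic linear factors have the same roots up to permutation, so [s] lists the
   diagonal of [D]. *)
have /prod_XsubC_eq sD : \prod_(x <- map f s) ('X - x%:P) =
    \prod_(x <- [seq D 0 i | i <- enum 'I_n]) ('X - x%:P).
  rewrite big_map [RHS]big_map big_enum /= -cB /B -map_char_poly cA rmorph_prod.
  by apply: eq_bigr => x _; rewrite rmorphB /= map_polyX map_polyC.
apply: (fmorph_inj f); rewrite -trace_map_mx /=.
have -> : map_mx f (A ^+ k) = B ^+ k.
  elim: k {PBk Dk} => [|k IH]; first by rewrite !expr0 map_mx1.
  by rewrite !exprS map_mxM IH.
have -> : B ^+ k = invmx P *m (diag_mx D ^+ k *m P) by rewrite -PBk mulKmx.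
rewrite mxtrace_mulC mulmxK // Dk mxtrace_diag rmorph_sum /=.
transitivity (\sum_(x <- map f s) x ^+ k).
  rewrite (perm_big _ sD) big_map big_enum /=.
  by apply: eq_bigr => i _; rewrite mxE.
by rewrite big_map; apply: eq_bigr => x _; rewrite rmorphXn.
Qed.

(** * Edge count and spectrum of the adjacency matrix *)

(** Each edge is the image of the ordered pairs (x, y) and (y, x), distinct because there are no
    loops. *)
Lemma card_adj_ge (G : sgraph) :
  (2 * #|edges G| <= #|[pred p : G * G | adj p.1 p.2]|)%N.
Proof.
rewrite -[X in (_ <= X)%N]sum1_card.
rewrite (partition_big_imset (fun p : G * G => [set p.1; p.2])) /=.
have -> : edges G =
    [set [set p.1; p.2] | p in [pred p : G * G | adj p.1 p.2]].
  apply/setP => e; apply/imsetP/imsetP => -[p pe ->];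
    by exists p => //; move: pe; rewrite !inE.
rewrite mulnC -sum_nat_const; apply: leq_sum => e.
case/imsetP => -[x y] /= xy ->.
have xNy : x != y by apply: contraTneq xy => ->; rewrite inE /= adj_irrefl.
rewrite inE /= in xy.
rewrite (bigD1 (x, y)) /= ?inE ?xy ?eqxx //.
rewrite (bigD1 (y, x)) //= ?inE /= adj_sym xy setUC eqxx /=.
by rewrite xpair_eqE negb_and eq_sym xNy.
Qed.

Section AdjacencyMatrix.

Context (R : realType) (G : sgraph).

Local Notation A := (adjmx R G).

Lemma adjmx_sym : A^T = A.
Proof. by apply/matrixP => i j; rewrite !mxE adj_sym. Qed.

Lemma sum_eigenvalues_exp k :
  \sum_(x <- eigenvalues A) x ^+ k = \tr (A ^+ k).
Proof.
by rewrite (mxtrace_exp_sym _ _ _ _ adjmx_sym (eigenvalues_split adjmx_sym)).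
Qed.

Lemma sum_eigenvalues : \sum_(x <- eigenvalues A) x = 0.
Proof.
transitivity (\tr (A ^+ 1)).
  by rewrite -sum_eigenvalues_exp; apply: eq_bigr => x _; rewrite expr1.
by rewrite expr1 /mxtrace big1 // => i _; rewrite mxE adj_irrefl.
Qed.

(** The trace of A^2 counts ordered adjacent pairs, since entries are 0 or 1 and A is symmetric. *)
Lemma sum_eigenvalues_sqr :
  2 * #|edges G|%:R <= \sum_(x <- eigenvalues A) x ^+ 2.
Proof.
rewrite sum_eigenvalues_exp /mxtrace -natrM.
apply: (@le_trans _ _ #|[pred p : G * G | adj p.1 p.2]|%:R).
  by rewrite ler_nat card_adj_ge.
have -> : #|[pred p : G * G | adj p.1 p.2]|%:R =
    \sum_(x : G) \sum_(y : G) (adj x y)%:R :> R.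
  rewrite -sum1_card natr_sum big_mkcond pair_bigA /=.
  by apply: eq_bigr => -[x y] _; rewrite inE /=; case: adj.
rewrite (reindex (@enum_val G G)) /=; last exact: onW_bij (enum_val_bij _).
apply: ler_sum => i _; rewrite expr2 -[_ * _]/(_ *m _) mxE.
rewrite (reindex (@enum_val G G)) /=; last exact: onW_bij (enum_val_bij _).
apply: ler_sum => j _; rewrite !mxE [adj (enum_val j) _]adj_sym.
by case: adj; rewrite ?mulr1 ?mulr0.
Qed.

(** A has nonnegative entries, hence so does A^3. *)
Lemma sum_eigenvalues_cube : 0 <= \sum_(x <- eigenvalues A) x ^+ 3.
Proof.
rewrite sum_eigenvalues_exp; apply: sumr_ge0 => i _.
rewrite !exprS expr0 mulr1 -[_ * (_ * _)]/(_ *m (_ *m _)) mxE.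
apply: sumr_ge0 => j _; rewrite mxE mulr_ge0 ?mxE ?ler0n //.
by apply: sumr_ge0 => l _; rewrite !mxE mulr_ge0.
Qed.

Lemma size_eigenvalues : size (eigenvalues A) = #|G|.
Proof.
apply: succn_inj; rewrite -(size_char_poly A) (eigenvalues_split adjmx_sym).
by rewrite size_prod_XsubC.
Qed.

Lemma eigenvalue_le_lambda1 : {in eigenvalues A, forall x, x <= lambda1 R G}.
Proof.
rewrite /lambda1; have := eigenvalues_sorted A.
case: (eigenvalues A) => //= y s ys x; rewrite inE => /predU1P[-> //|xs].
have tr : transitive (>=%R : rel R) by move=> a b c /[swap] /le_trans h /h.
exact: (allP (order_path_min tr ys)).
Qed.

Lemma edges_pow4_le :
  #|edges G|%:R ^+ 4 <= #|G|%:R * lambda1 R G ^+ 2 * s_plus R G ^+ 3.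
Proof.
rewrite -size_eigenvalues; apply: pos_square_sum_bound => //.
- exact: eigenvalue_le_lambda1.
- exact: sum_eigenvalues.
- exact: sum_eigenvalues_sqr.
- exact: sum_eigenvalues_cube.
Qed.

Lemma s_plus_ge0 : 0 <= s_plus R G.
Proof. by apply: sumr_ge0 => x _; exact: sqr_ge0. Qed.

Lemma s_plus_eq0 : lambda1 R G <= 0 -> s_plus R G = 0.
Proof.
move=> l0; rewrite /s_plus big1_seq // => x /andP[x0 xs].
have /eqP -> : x == 0; last by rewrite expr0n.
by rewrite eq_le x0 (le_trans (eigenvalue_le_lambda1 _ xs)).
Qed.

End AdjacencyMatrix.

(** * From the polynomial bound to fractional powers *)

Lemma powR_third_cube {R : realType} (a : R) (k : nat) : 0 <= a ->
  (a `^ (k%:R / 3)) ^+ 3 = a ^+ k.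
Proof.
move=> a0; rewrite -powR_mulrn ?powR_ge0 // -powRrM divfK ?powR_mulrn //.
by rewrite pnatr_eq0.
Qed.

Theorem theorem1p16 (R : realType) (G : sgraph) (n m : nat)
    (n_def : n = #|G|) (m_def : m = #|edges G|) (m_ge1 : (1 <= m)%N) :
  s_plus R G >=
    (m%:R `^ (4 / 3)) / (n%:R `^ (1 / 3) * lambda1 R G `^ (2 / 3)).
Proof.
have := edges_pow4_le R G; rewrite -n_def -m_def => bound.
have m4 : 0 < m%:R ^+ 4 :> R by rewrite exprn_gt0 ?ltr0n.
(* Otherwise [s_plus] vanishes and [bound] would give m^4 <= 0. *)
have l0 : 0 < lambda1 R G.
  rewrite ltNge; apply/negP => /s_plus_eq0 s0.
  by move: bound; rewrite s0 expr0n mulr0 leNgt m4.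
have n0 : 0 < n%:R :> R.
  rewrite lt0r ler0n andbT; apply: contraTneq bound => ->.
  by rewrite !mul0r -ltNge.
have den0 : 0 <= n%:R `^ (1 / 3) * lambda1 R G `^ (2 / 3).
  by rewrite mulr_ge0 ?powR_ge0.
(* Both sides are nonnegative; cubing them turns the goal into m^4 / (n * lambda1^2) <= s_plus^3,
   which is [bound]. *)
rewrite -(@ler_pXn2r _ 3) ?nnegrE ?s_plus_ge0 ?divr_ge0 ?powR_ge0 //.
rewrite expr_div_n exprMn (powR_third_cube _ 4) ?ler0n //.
rewrite (powR_third_cube _ 1) ?(powR_third_cube _ 2) ?(ltW l0) ?(ltW n0) //.
by rewrite expr1 ler_pdivrMr ?mulr_gt0 ?exprn_gt0 // mulrC.
Qed.
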